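(* Let $G=(V,E)$, $D=(E,A)$, $\ell$, $\lambda$, $w$ be an instance of LRU Design. Then all extreme optimal points of the feasible polyhedron of LPM are integer; that is, every extreme point $x^*$ of the feasible polyhedron of LPM that is an optimal solution to LPM satisfies $x^*_Q\in\{0,1\}$ for all $Q\in\mathscr{S}$.
   Context: Instance. $G=(V,E)$ is a finite connected undirected graph (the connection graph). $D=(E,A)$ is an acyclic directed graph whose vertex set is the edge set $E$ of $G$ (the precedence graph); arcs only join adjacent edges of $G$, i.e. every arc in $A$ is of the form $(\{u,v\},\{v,x\})$ with $u,v,x\in V$. Let $\mathbb{R}_+=\{x\in\mathbb{R}: x>0\}$. There are purchase costs $\ell:V\to\mathbb{R}_+$, edge costs $w:E\to\mathbb{R}_+$, and a failure rate function $\lambda:2^V\to\mathbb{R}$ with $\lambda(Q)>0$ for every nonempty $Q\subseteq V$, $\lambda(\emptyset)=0$, which is superadditive: $\lambda(R)+\lambda(T)\le\lambda(R\cup T)$ for all disjoint $R,T\subseteq V$. Costs. For $e\in E$, $H(e)\subseteq E$ is the set of all edges (including $e$ itself) reachable from $e$ by a directed path in $D$. For $Q\subseteq V$, $B(Q)=\{\{u,v\}\in E: u\in Q, v\in V\setminus Q\}$ and $\Gamma(Q)=\bigcup_{e\in B(Q)}H(e)$. The cost of a LRU $Q\subseteq V$ is $$\omega(Q)=\lambda(Q)\Big(\sum_{e\in\Gamma(Q)}w(e)+\sum_{u\in Q}\ell(u)\Big).$$ LPM. Let $\mathscr{S}=2^V$ be the set of all possible LRUs, and for $v\in V$, $Q\in\mathscr{S}$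 let $z_{vQ}=1$ if $v\in Q$ and $z_{vQ}=0$ otherwise. LPM is the linear program $$\min_{x}\ \sum_{Q\in\mathscr{S}}\omega(Q)x_Q\quad\text{s.t.}\quad \sum_{Q\in\mathscr{S}}z_{vQ}x_Q=1\ \ \forall v\in V,\qquad 0\le x_Q\le 1\ \ \forall Q\in\mathscr{S}.$$ *)

(* Defs.v *)
From mathcomp Require Import all_boot all_order all_algebra.
From mathcomp Require Import reals.

Set Implicit Arguments.
Unset Strict Implicit.
Unset Printing Implicit Defensive.

Import Order.TTheory GRing.Theory Num.Theory.
Local Open Scope ring_scope.

(* A graph on [V] is given by its edge set [E]; the edge {u,v} is the set
   [set u; v], so [#|e| = 2] excludes loops and parallel edges. *)
Definition simple_graph (V : finType) (E : {set {set V}}) : Prop :=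
  forall e, e \in E -> #|e| = 2%N.

Definition adjacent (V : finType) (E : {set {set V}}) : rel V :=
  fun u v => [set u; v] \in E.

Definition connected_graph (V : finType) (E : {set {set V}}) : Prop :=
  forall u v : V, connect (adjacent E) u v.

(* The arcs of the digraph D = (E, A) are a relation on all of {set V}; the
   first clause confines them to the vertex set E of D. *)
Definition precedence_graph (V : finType) (E : {set {set V}})
    (A : rel {set V}) : Prop :=
  [/\ (forall e f, A e f -> e \in E /\ f \in E),
      (forall e f, A e f ->
         exists u v x : V, e = [set u; v] /\ f = [set v; x])
    & (forall c : seq {set V}, ucycle A c -> c = [::])].

Definition failure_rate (R : realType) (V : finType)
    (lam : {set V} -> R) : Prop :=
  [/\ lam set0 = 0,
      (forall Q : {set V}, Q != set0 -> 0 < lam Q)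
    & (forall S T : {set V}, [disjoint S & T] ->
         lam S + lam T <= lam (S :|: T))].

(* [reach], [boundary], [broken] and [lru_cost] are usually written H, B,
   Gamma and omega. *)
Definition reach (V : finType) (E : {set {set V}}) (A : rel {set V})
    (e : {set V}) : {set {set V}} :=
  [set f in E | connect A e f].

Definition boundary (V : finType) (E : {set {set V}}) (Q : {set V}) :
    {set {set V}} :=
  [set e in E | [exists u in Q, exists v in ~: Q, e == [set u; v]]].

Definition broken (V : finType) (E : {set {set V}}) (A : rel {set V})
    (Q : {set V}) : {set {set V}} :=
  \bigcup_(e in boundary E Q) reach E A e.

Definition lru_cost (R : realType) (V : finType) (E : {set {set V}})
    (A : rel {set V}) (ell : V -> R) (w : {set V} -> R) (lam : {set V} -> R)
    (Q : {set V}) : R :=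
  lam Q * (\sum_(e in broken E A Q) w e + \sum_(u in Q) ell u).

(* The variables x_Q range over all Q in {set V}, the empty set included. *)
Definition lpm_feasible (R : realType) (V : finType)
    (x : {ffun {set V} -> R}) : Prop :=
  (forall v : V, \sum_(Q : {set V}) (v \in Q)%:R * x Q = 1) /\
  (forall Q : {set V}, 0 <= x Q <= 1).

Definition lpm_objective (R : realType) (V : finType) (E : {set {set V}})
    (A : rel {set V}) (ell : V -> R) (w : {set V} -> R) (lam : {set V} -> R)
    (x : {ffun {set V} -> R}) : R :=
  \sum_(Q : {set V}) lru_cost E A ell w lam Q * x Q.

Definition lpm_optimal (R : realType) (V : finType) (E : {set {set V}})
    (A : rel {set V}) (ell : V -> R) (w : {set V} -> R) (lam : {set V} -> R)
    (x : {ffun {set V} -> R}) : Prop :=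
  lpm_feasible x /\
  (forall y : {ffun {set V} -> R}, lpm_feasible y ->
     lpm_objective E A ell w lam x <= lpm_objective E A ell w lam y).

Definition extreme_point (R : realType) (I : finType)
    (P : {ffun I -> R} -> Prop) (x : {ffun I -> R}) : Prop :=
  P x /\
  (forall (y z : {ffun I -> R}) (t : R), P y -> P z -> 0 < t < 1 ->
     x = [ffun i => t * y i + (1 - t) * z i] -> y = x /\ z = x).

(* Main.v *)
Require Import Defs.
From mathcomp Require Import all_boot all_order all_algebra.
From mathcomp Require Import reals lra.

Import Order.TTheory GRing.Theory Num.Theory.
Local Open Scope ring_scope.

(** Write the cost of [Q] as [lam Q * c Q] with [c Q = h Q + ell Q], where
    [h Q] is the weight of the edges broken by [Q] and [ell Q] the purchase
    cost.  Consecutive edges of a precedence path share a vertex, so the edges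
    from which a given edge [f] can be reached form a connected subgraph, and
    [f] is broken by [Q] exactly when [Q] splits the vertex set of that
    subgraph ([brokenE]).  Hence [h] is the cut function of a weighted
    hypergraph, which makes it submodular and posimodular.

    Let [x] be optimal and [x Q > 0].  Moving weight from [Q] to the parts of
    a partition of [Q] does not lower the objective; since [lam] is
    superadditive, some part [X] satisfies [c Q <= c X].  If every vertex of
    [Q] lay in some [X] inside [Q] with [c X < c Q], uncrossing these sets by
    posimodularity would produce a partition with only such parts.  So some
    vertex [u] of [Q] has [c Q <= c X] whenever [u] is in [X] and [X] is a
    subset of [Q]; as [ell] is positive this reads [h Q < h X] for proper
    [X].  Such a [u] is called an anchor of [Q] ([optimal_anchors]).

    The combinatorial core is that a fractional exact cover all of whose
    supporting sets are anchored has an integral exact cover in its support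
    ([anchored_supports_are_integral]).  Vertices are eliminated one at a
    time.  As at a leaf of a Gomory-Hu tree, there is a vertex [v] such that
    [[set v]] is a minimum cut of [h] between [v] and some other point
    ([exists_pendant]); then an anchored set other than [[set v]] always has
    an anchor besides [v].  Minimising [h] over the two positions of [v]
    keeps it submodular and posimodular and keeps those anchors, so induction
    applies to the traces of the sets on the remaining vertices.  Two sets of
    the support other than [[set v]] cannot have only [v] in common, by
    posimodularity again, so a cover of the remaining vertices covers [v] at most once.  That [v] can
    be covered exactly once requires choosing the right cover of the rest;
    this is why the induction bounds the best value of an arbitrary linear
    objective, i.e. proves integrality of the whole face spanned by the
    support.

    An extreme optimal [x] is a proper convex combination of the integral
    cover found in its support and of another feasible point, hence equals
    that cover on all nonempty sets.  The coordinate of the empty set meets no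
    covering constraint and is extreme only at 0 and 1. *)

(** * Cut-like set functions and anchors *)

Definition submodular {V : finType} {R : realFieldType} (h : {set V} -> R) :=
  forall X Y, h (X :|: Y) + h (X :&: Y) <= h X + h Y.

Definition posimodular {V : finType} {R : realFieldType} (h : {set V} -> R) :=
  forall X Y, h (X :\: Y) + h (Y :\: X) <= h X + h Y.

Definition anchors {V : finType} {R : realFieldType} (h : {set V} -> R)
    (T : {set V}) (u : V) : bool :=
  (u \in T) &&
  [forall X : {set V}, (u \in X) && (X \proper T) ==> (h T < h X)].

Lemma anchorsP {V : finType} {R : realFieldType} (h : {set V} -> R)
    (T : {set V}) (u : V) :
  reflect (u \in T /\
           forall X : {set V}, u \in X -> X \proper T -> h T < h X)
          (anchors h T u).
Proof.
apply: (iffP andP) => -[uT H]; split=> //.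
  by move=> X uX XT; move/forallP/(_ X)/implyP: H; apply; rewrite uX.
by apply/forallP=> X; apply/implyP=> /andP[]; apply: H.
Qed.

(** * Pendant vertices *)

(** [None] is an additional point, outside every subset of [V].  With it, the
    pair submodular and posimodular says that [h] is a symmetric submodular
    function on [option V], each cut being named by its side without [None]. *)
Definition in_opt {V : finType} (t : option V) (X : {set V}) : bool :=
  if t is Some u then u \in X else false.

Definition min_cut {V : finType} {R : realFieldType} (h : {set V} -> R)
    (W X : {set V}) (s : V) (t : option V) : Prop :=
  [/\ X \subset W, s \in X, ~~ in_opt t X &
      forall Y : {set V}, Y \subset W -> (s \in Y) != in_opt t Y ->
        h X <= h Y].

(** Uncrossing as in the Gomory-Hu construction: if a minimum [s]-[t] cut [X]
    contains two points, a minimum cut [Y] between them can be replaced by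
    [X :&: Y] or [X :\: Y], because the other set of the uncrossed pair still
    separates [s] from [t] and so costs at least [h X]. *)
Lemma min_cut_shrink {V : finType} {R : realFieldType} (h : {set V} -> R)
    (W X : {set V}) (s : V) (t : option V) (a b : V) :
  submodular h -> posimodular h -> min_cut h W X s t ->
  a \in X -> b \in X -> a != b ->
  exists (Z : {set V}) (s' : V) (t' : option V),
    (#|Z| < #|X|)%N /\ min_cut h W Z s' t'.
Proof.
move=> subh posh [XW sX tX Xmin] aX bX ab.
pose sep (Y : {set V}) := (Y \subset W) && ((a \in Y) != (b \in Y)).
have sep0 : sep [set a].
  by rewrite /sep sub1set (subsetP XW) // !inE eqxx [b == a]eq_sym (negbTE ab).
case: (arg_minP h sep0) => Y /andP[YW abY] Ymin.
have shrunk (Z : {set V}) : Z \subset X -> h Z <= h Y ->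
    (a \in Z) != (b \in Z) -> exists (Z : {set V}) (s' : V) (t' : option V),
    (#|Z| < #|X|)%N /\ min_cut h W Z s' t'.
  move=> ZX hZ abZ.
  have ZW := subset_trans ZX XW.
  have Zlt : (#|Z| < #|X|)%N.
    apply: proper_card; rewrite properE ZX; apply: contra abZ => /subsetP XZ.
    by rewrite !XZ.
  case aZ: (a \in Z) abZ => bZ.
    exists Z, a, (Some b); split=> //.
    split=> //= U UW abU.
    by apply: le_trans hZ (Ymin _ _); rewrite /sep UW.
  exists Z, b, (Some a); split=> //.
  split; rewrite /= ?aZ //; first by case: (b \in Z) bZ.
  move=> U UW abU.
  by apply: le_trans hZ (Ymin _ _); rewrite /sep UW eq_sym.
(* Which uncrossing applies depends on the side of Y that holds t. *)
case tY: (in_opt t Y).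
  apply: (shrunk (X :\: Y)); first exact: subsetDl.
    have := posh X Y.
    suff : h X <= h (Y :\: X) by lra.
    apply: Xmin; first exact: subset_trans (subsetDl _ _) YW.
    by case: t tX tY => //= u uX uY; rewrite !inE sX uY (negbTE uX).
  by rewrite !inE aX bX !andbT; case: (a \in Y) abY; case: (b \in Y).
apply: (shrunk (X :&: Y)); first exact: subsetIl.
  have := subh X Y.
  suff : h X <= h (X :|: Y) by lra.
  apply: Xmin; first by rewrite subUset XW.
  rewrite inE sX /=.
  by case: t tX tY => //= u uX uY; rewrite !inE uY (negbTE uX).
by rewrite !inE aX bX.
Qed.

(** Shrink a minimum cut between a vertex and [None] until it is a singleton. *)
Lemma exists_pendant {V : finType} {R : realFieldType} (h : {set V} -> R)
    (W : {set V}) :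
  submodular h -> posimodular h -> W != set0 ->
  exists (v : V) (t : option V), min_cut h W [set v] v t.
Proof.
move=> subh posh /set0Pn[w wW].
have [X [s [t XX]]] : exists X s t, min_cut h W X s t.
  pose has (Y : {set V}) := (Y \subset W) && (w \in Y).
  have has0 : has W by rewrite /has subxx.
  case: (arg_minP h has0) => X /andP[XW wX] Xmin.
  exists X, w, None; split=> // Y YW wY.
  by apply: Xmin; rewrite /has YW; case: (w \in Y) wY.
have [n] := ubnP #|X|; elim: n => // n IHn in X s t XX *.
rewrite ltnS => Xn; have [XW sX tX Xmin] := XX.
have [X1|[b bX bs]] : X = [set s] \/ exists2 b, b \in X & b != s.
  case: (set_0Vmem (X :\ s)) => [X0|[b]]; last first.
    by rewrite !inE => /andP[? ?]; right; exists b.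
  by left; rewrite -(setD1K sX) X0 setU0.
  by exists s, t; rewrite -X1.
have [|Z [s' [t' [ZX ZZ]]]] := min_cut_shrink _ _ _ _ _ s b subh posh XX sX bX.
  by rewrite eq_sym.
by apply: IHn ZZ _; apply: leq_trans ZX Xn.
Qed.

(** Assume that [v] anchors [T], so [h T < h [set v]].  As [[set v]] is a
    minimum cut between [v] and [t], the set [T] contains [t].  A subset of [T]
    witnessing that [t] is no anchor would avoid [v], hence separate [v] from
    [t] at a cost below [h [set v]]. *)
Lemma pendant_not_sole_anchor {V : finType} {R : realFieldType}
    (h : {set V} -> R) (W T : {set V}) (v : V) (t : option V) :
  min_cut h W [set v] v t -> T \subset W -> T != [set v] ->
  (exists u, anchors h T u) -> exists2 u, anchors h T u & u != v.
Proof.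
move=> [_ _ tv vmin] TW Tv [u hu].
have [uv|] := eqVneq u v; last by exists u.
rewrite {u}uv in hu; have /anchorsP[vT vanch] := hu.
have hTv : h T < h [set v].
  by apply: vanch; rewrite ?inE // properEneq eq_sym Tv sub1set.
case tT: (in_opt t T); last first.
  by have := vmin T TW; rewrite vT tT => /(_ isT); lra.
case: t tv tT vmin => //= z; rewrite inE => zv zT vmin.
exists z => //; apply/anchorsP; split=> // X zX XT.
rewrite ltNge; apply/negP=> hXT.
case vX: (v \in X); first by have := vanch X vX XT; lra.
have := vmin X (subset_trans (proper_sub XT) TW).
by rewrite vX zX => /(_ isT); lra.
Qed.

(** * Eliminating a vertex *)

(** Partial minimisation over the two positions of [v]: the value depends only
    on the trace of [X] outside [v]. *)
Definition delete {V : finType} {R : realFieldType} (v : V)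
    (h : {set V} -> R) (X : {set V}) : R :=
  Num.min (h (X :\ v)) (h (v |: X)).

Lemma delete_attained {V : finType} {R : realFieldType} (v : V)
    (h : {set V} -> R) (X : {set V}) :
  exists2 A : {set V}, A :\ v = X :\ v & delete v h X = h A.
Proof.
rewrite /delete; case: leP => _; [exists (X :\ v)|exists (v |: X)] => //.
  by apply/setP=> z; rewrite !inE andbA andbb.
by apply/setP=> z; rewrite !inE; case: (z == v).
Qed.

Lemma delete_le {V : finType} {R : realFieldType} (v : V)
    (h : {set V} -> R) (X A : {set V}) :
  A :\ v = X :\ v -> delete v h X <= h A.
Proof.
move=> AX; rewrite /delete ge_min.
case vA: (v \in A).
  suff -> : v |: X = A by rewrite lexx orbT.
  apply/setP=> z; move/setP/(_ z): AX; rewrite !inE.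
  by have [->|] := eqVneq z v.
suff -> : X :\ v = A by rewrite lexx.
rewrite -AX; apply/setP=> z; rewrite !inE.
by have [->|] := eqVneq z v.
Qed.

Lemma delete_submodular {V : finType} {R : realFieldType} (v : V)
    (h : {set V} -> R) : submodular h -> submodular (delete v h).
Proof.
move=> subh X Y.
have [A AX ->] := delete_attained v h X.
have [B BY ->] := delete_attained v h Y.
apply: le_trans (subh A B); apply: lerD; apply: delete_le.
  by rewrite !setDUl AX BY.
by rewrite !setDIl AX BY.
Qed.

Lemma delete_posimodular {V : finType} {R : realFieldType} (v : V)
    (h : {set V} -> R) : posimodular h -> posimodular (delete v h).
Proof.
move=> posh X Y.
have [A AX ->] := delete_attained v h X.
have [B BY ->] := delete_attained v h Y.
have traceD (P Q P' Q' : {set V}) : P :\ v = P' :\ v -> Q :\ v = Q' :\ v ->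
    (P :\: Q) :\ v = (P' :\: Q') :\ v.
  move=> /setP eP /setP eQ; apply/setP=> z.
  by move: (eP z) (eQ z); rewrite !inE; case: (z == v) => //= -> ->.
by apply: le_trans (posh A B); apply: lerD; apply: delete_le; apply: traceD.
Qed.

(** When [v] is outside [T], a set [v |: X] is not a subset of [T], but
    submodularity of [h] on [v |: X] and [T] bounds [h (v |: X)] below by
    [h (v |: T)] plus the positive gap [h X - h T]. *)
Lemma delete_anchors {V : finType} {R : realFieldType} (v u : V)
    (h : {set V} -> R) (T : {set V}) :
  submodular h -> anchors h T u -> u != v ->
  anchors (delete v h) (T :\ v) u.
Proof.
move=> subh /anchorsP[uT anch] uv.
apply/anchorsP; split=> [|X uX XT]; first by rewrite !inE uv.
have vX : v \notin X.
  by apply/negP=> /(subsetP (proper_sub XT)); rewrite !inE eqxx.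
have XvT : X :\ v = X.
  apply/setP=> z; rewrite !inE.
  by have [->|] := eqVneq z v; rewrite ?(negbTE vX).
have XsT : X \proper T by apply: proper_sub_trans XT (subsetDl _ _).
have hX := anch X uX XsT.
have -> : delete v h X = Num.min (h X) (h (v |: X)) by rewrite /delete XvT.
rewrite lt_min.
case vT: (v \in T).
  have XvsT : v |: X \proper T.
    rewrite -(setD1K vT) properE setUS ?(proper_sub XT) //=.
    apply: contraTN XT => /subsetP TX; rewrite properE negb_and negbK.
    apply/orP; right; apply/subsetP=> z; rewrite !inE => /andP[zv zT].
    by have := TX z; rewrite !inE zT zv (negbTE zv); apply.
  have := anch _ (setU1r v uX) XvsT.
  have : delete v h (T :\ v) <= h T.
    by apply: delete_le; apply/setP=> z; rewrite !inE andbA andbb.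
  by move=> h1 h2; apply/andP; split; lra.
have -> : T :\ v = T.
  by apply/setP=> z; rewrite !inE; have [->|] := eqVneq z v; rewrite ?vT.
have hv : h (v |: T) + h X <= h (v |: X) + h T.
  have := subh (v |: X) T.
  have -> : (v |: X) :|: T = v |: T.
    by rewrite -setUA (setUidPr (proper_sub XsT)).
  suff -> : (v |: X) :&: T = X by [].
  rewrite setIUl (setIidPl (proper_sub XsT)).
  rewrite (_ : [set v] :&: T = set0) ?set0U //.
  by apply/setP=> z; rewrite !inE; have [->|] := eqVneq z v; rewrite ?vT.
have := @delete_le _ _ v h T T erefl.
have : delete v h T <= h (v |: T) by rewrite /delete ge_min lexx orbT.
by move=> h1 h2; apply/andP; split; lra.
Qed.

(** If two sets met only in [v], posimodularity would make one of [T :\ v] and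
    [T' :\ v] at most as costly as [T] or [T'], against the anchor it
    contains. *)
Lemma anchored_sets_share_more {V : finType} {R : realFieldType}
    (h : {set V} -> R) (T T' : {set V}) (v u u' : V) :
  posimodular h -> anchors h T u -> anchors h T' u' ->
  u != v -> u' != v -> T :&: T' != [set v].
Proof.
move=> posh /anchorsP[uT anch] /anchorsP[uT' anch'] uv uv'; apply/eqP=> TT'.
have vT : v \in T by have := set11 v; rewrite -TT' inE => /andP[].
have vT' : v \in T' by have := set11 v; rewrite -TT' inE => /andP[].
have := posh T T'.
have -> : T :\: T' = T :\ v by rewrite -TT' setDIr setDv set0U.
have -> : T' :\: T = T' :\ v by rewrite -TT' setDIr setDv setU0.
have : h T < h (T :\ v) by apply: anch; rewrite ?properD1 // !inE uv.
have : h T' < h (T' :\ v) by apply: anch'; rewrite ?properD1 // !inE uv'.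
lra.
Qed.

(** * Integrality for anchored families *)

Definition exact_cover {V : finType} (W : {set V}) (C : {set {set V}}) : Prop :=
  forall v, v \in W -> #|[set Q in C | v \in Q]| = 1%N.

Lemma sum_indicator {V : finType} {R : realFieldType} (C : {set {set V}})
    (v : V) :
  \sum_(Q in C) (v \in Q)%:R = #|[set Q in C | v \in Q]|%:R :> R.
Proof.
rewrite -natr_sum; congr _%:R; rewrite -sum1_card big_mkcond [RHS]big_mkcond.
by apply: eq_bigr => Q _; rewrite inE; case: (Q \in C); case: (v \in Q).
Qed.

(** Induction on [W], keeping the sets [Q] and the weights [x] fixed and looking
    at the traces [Q :&: W].  The objective [d] is what lets [v] be put back:
    subtracting a price [delta] for covering [v] and covering the other
    vertices optimally makes the cover found behave, on the constraint of
    [v], like the fractional one. *)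
Lemma anchored_supports_are_integral {V : finType} {R : realFieldType}
    (x : {set V} -> R) (W : {set V}) (h : {set V} -> R) (d : {set V} -> R) :
  (forall Q, 0 <= x Q) ->
  submodular h -> posimodular h ->
  (forall v, v \in W -> \sum_(Q : {set V}) (v \in Q)%:R * x Q = 1) ->
  (forall Q, 0 < x Q -> Q :&: W != set0 ->
     exists u, anchors h (Q :&: W) u) ->
  exists C : {set {set V}},
    [/\ forall Q, Q \in C -> 0 < x Q /\ Q :&: W != set0,
        exact_cover W C
      & \sum_(Q : {set V} | Q :&: W != set0) x Q * d Q <= \sum_(Q in C) d Q].
Proof.
move=> x0; have [n] := ubnP #|W|.
elim: n => // n IHn in W h d *; rewrite ltnS => Wn subh posh cov anch.
have [W0|Wn0] := eqVneq W set0.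
  exists set0; split=> [Q|v|]; rewrite ?W0 ?inE //.
  by rewrite big_set0 big_pred0 // => Q; rewrite setI0 eqxx.
have [v [t vt]] := exists_pendant h W subh posh Wn0.
have vW : v \in W by case: vt; rewrite sub1set.
have anchv (Q : {set V}) : 0 < x Q -> Q :&: W != set0 -> Q :&: W != [set v] ->
    exists2 u, anchors h (Q :&: W) u & u != v.
  move=> xQ QW Qv.
  exact: pendant_not_sole_anchor vt (subsetIr _ _) Qv (anch _ xQ QW).
pose W' := W :\ v.
have IW' (Q : {set V}) : Q :&: W' = (Q :&: W) :\ v.
  by rewrite setIDA.
have meetW' (Q : {set V}) :
    (Q :&: W' != set0) = (Q :&: W != set0) && (Q :&: W != [set v]).
  rewrite IW' setD_eq0 subset1; case: eqP => //=; first by rewrite andbF.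
  by rewrite andbT.
have {}IHn d' := IHn W' (delete v h) d'.
have W'n : (#|W'| < n)%N.
  by move: Wn; rewrite (cardsD1 v W) vW.
have cov' u : u \in W' -> \sum_(Q : {set V}) (u \in Q)%:R * x Q = 1.
  by rewrite !inE => /andP[_]; apply: cov.
have anch' (Q : {set V}) : 0 < x Q -> Q :&: W' != set0 ->
    exists u, anchors (delete v h) (Q :&: W') u.
  move=> xQ; rewrite meetW' IW' => /andP[QW Qv].
  have [u hu uv] := anchv Q xQ QW Qv.
  by exists u; apply: delete_anchors.
have {}IHn d' := IHn d' W'n (delete_submodular v h subh)
  (delete_posimodular v h posh) cov' anch'.
pose trv := [pred Q : {set V} | Q :&: W == [set v]].
have trvI (Q : {set V}) : trv Q -> v \in Q.
  by move/eqP=> QW; have := set11 v; rewrite -QW inE => /andP[].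
have splitW (F : {set V} -> R) :
    \sum_(Q : {set V} | Q :&: W != set0) F Q =
    \sum_(Q : {set V} | Q :&: W' != set0) F Q + \sum_(Q | trv Q) F Q.
  rewrite [LHS](bigID trv) [LHS]addrC /=; congr (_ + _); apply: eq_bigl => Q.
    by rewrite meetW'.
  have [->|_] := eqVneq (Q :&: W) [set v]; last by rewrite andbF.
  by rewrite andbT; apply/set0Pn; exists v; rewrite inE.
have covv : \sum_(Q : {set V} | Q :&: W' != set0) (v \in Q)%:R * x Q +
    \sum_(Q | trv Q) x Q = 1.
  rewrite -[RHS](cov v vW) [RHS](bigID (fun Q : {set V} => Q :&: W != set0)) /=.
  rewrite [X in _ = _ + X]big1 ?addr0 => [|Q]; last first.
    rewrite negbK => /eqP /setP /(_ v); rewrite !inE vW andbT => ->.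
    by rewrite mul0r.
  rewrite splitW; congr (_ + _); apply: eq_bigr => Q /trvI ->.
  by rewrite mul1r.
have atmost1 (C : {set {set V}}) :
    (forall Q, Q \in C -> 0 < x Q /\ Q :&: W' != set0) -> exact_cover W' C ->
    (#|[set Q in C | v \in Q]| <= 1)%N.
  move=> Csup Cex; rewrite leqNgt; apply/negP=> /card_gt1P[Q [Q']].
  rewrite !inE => -[/andP[QC vQ] /andP[QC' vQ'] QQ'].
  have [xQ] := Csup Q QC; rewrite meetW' => /andP[QW Qv].
  have [xQ'] := Csup Q' QC'; rewrite meetW' => /andP[QW' Qv'].
  have [u hu uv] := anchv Q xQ QW Qv.
  have [u' hu' uv'] := anchv Q' xQ' QW' Qv'.
  have /eqP[] := anchored_sets_share_more h _ _ v u u' posh hu hu' uv uv'.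
  apply/setP=> z; rewrite !inE.
  have [->|zv] := eqVneq z v; first by rewrite vQ vQ' vW.
  apply/negP=> /andP[/andP[zQ zW] /andP[zQ' _]].
  have zW' : z \in W' by rewrite !inE zv.
  have /eqP/cards1P[P PP] := Cex z zW'.
  have : Q \in [set P] by rewrite -PP inE QC.
  have : Q' \in [set P] by rewrite -PP inE QC'.
  by rewrite !inE => /eqP Q'P /eqP QP; rewrite QP Q'P eqxx in QQ'.
(* The induction hypothesis for d with a price delta on the sets through v. *)
have tilt (delta : R) : exists C : {set {set V}},
    [/\ forall Q, Q \in C -> 0 < x Q /\ Q :&: W' != set0,
        exact_cover W' C
      & \sum_(Q : {set V} | Q :&: W' != set0) x Q * d Q
        - delta * (\sum_(Q : {set V} | Q :&: W' != set0) (v \in Q)%:R * x Q)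
        <= \sum_(Q in C) d Q - delta * #|[set Q in C | v \in Q]|%:R].
  have [C [Csup Cex Cd]] := IHn (fun Q => d Q - delta * (v \in Q)%:R).
  exists C; split=> //; move: Cd.
  rewrite sumrB -mulr_sumr sum_indicator.
  congr (_ <= _); rewrite mulr_sumr -sumrB; apply: eq_bigr => Q _.
  by rewrite mulrBr; congr (_ - _); rewrite [x Q * _]mulrC mulrA.
have lift (C : {set {set V}}) :
    (forall Q, Q \in C -> 0 < x Q /\ Q :&: W' != set0) ->
    forall Q, Q \in C -> 0 < x Q /\ Q :&: W != set0.
  by move=> Csup Q /Csup[xQ]; rewrite meetW' => /andP[].
have [/existsP[Q1 /andP[xQ1 trQ1]]|] := boolP [exists Q, (0 < x Q) && trv Q].
  (* If a cover of the rest misses v, add the best set Q0 of trace [set v];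
     pricing v at d Q0 makes both situations equally good. *)
  pose sv (Q : {set V}) := (0 < x Q) && trv Q.
  have svQ1 : sv Q1 by rewrite /sv xQ1.
  case: (arg_maxP d svQ1) => Q0 /andP[xQ0 trQ0] Q0max.
  have [C [Csup Cex Cd]] := tilt (d Q0).
  have Bd : \sum_(Q | trv Q) x Q * d Q <= d Q0 * \sum_(Q | trv Q) x Q.
    rewrite mulr_sumr; apply: ler_sum => Q trQ; rewrite mulrC.
    have := x0 Q; rewrite le_eqVlt => /orP[/eqP<-|xQ]; first by rewrite !mulr0.
    by rewrite ler_pM2r //; apply: Q0max; rewrite /sv xQ.
  have := atmost1 C Csup Cex.
  rewrite leq_eqVlt => /orP[/eqP n1|].
    exists C; split; [exact: lift | | ].
      move=> u uW; have [->|uv] := eqVneq u v; first exact: n1.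
      by apply: Cex; rewrite !inE uv.
    rewrite splitW; rewrite n1 in Cd.
    have : d Q0 * (\sum_(Q : {set V} | Q :&: W' != set0) (v \in Q)%:R * x Q) +
      d Q0 * (\sum_(Q | trv Q) x Q) = d Q0 by rewrite -mulrDr covv mulr1.
    lra.
  rewrite ltnS leqn0 => /eqP n0.
  have Q0C : Q0 \notin C.
    apply/negP=> /Csup[_]; rewrite meetW' => /andP[_].
    by rewrite (eqP trQ0) eqxx.
  have vC Q : Q \in C -> v \notin Q.
    move=> QC; apply/negP=> vQ; move/eqP: n0.
    rewrite cards_eq0 => /eqP/setP/(_ Q).
    by rewrite !inE QC vQ.
  exists (Q0 |: C); split.
  - move=> Q /setU1P[->|QC]; last exact: lift QC.
    split=> //; apply/set0Pn; exists v; by rewrite (eqP trQ0) inE.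
  - move=> u uW; have [->|uv] := eqVneq u v.
      apply/eqP/cards1P; exists Q0; apply/setP=> Q; rewrite !inE.
      have [->|] := eqVneq Q Q0; first by rewrite trvI.
      by move=> _ /=; case QC: (Q \in C) => //=; apply/negbTE/vC.
    have uW' : u \in W' by rewrite !inE uv.
    rewrite -(Cex u uW'); congr #|pred_of_set _|; apply/setP=> Q; rewrite !inE.
    have [->|//] := eqVneq Q Q0; rewrite (negbTE Q0C) /=.
    have : u \in Q0 :&: W = false by rewrite (eqP trQ0) inE (negbTE uv).
    by rewrite inE uW andbT.
  rewrite splitW big_setU1 //=; rewrite n0 in Cd.
  have : d Q0 * (\sum_(Q : {set V} | Q :&: W' != set0) (v \in Q)%:R * x Q) +
    d Q0 * (\sum_(Q | trv Q) x Q) = d Q0 by rewrite -mulrDr covv mulr1.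
  lra.
(* Otherwise v carries full fractional weight on the sets that survive its
   elimination, and a reward K larger than any possible loss in d forces the
   integral cover to pass through v too. *)
move=> /existsPn notrv.
have trx Q : trv Q -> x Q = 0.
  move=> trQ; apply/eqP; have := notrv Q; rewrite trQ andbT -leNgt => xQ.
  by rewrite eq_le xQ x0.
have trv0 : \sum_(Q | trv Q) x Q = 0 by apply: big1 => Q /trx.
have trd0 : \sum_(Q | trv Q) x Q * d Q = 0.
  by apply: big1 => Q /trx ->; rewrite mul0r.
pose A := \sum_(Q : {set V} | Q :&: W' != set0) x Q * d Q.
pose K := 1 + \sum_(Q : {set V}) `|d Q| - A.
have [C [Csup Cex Cd]] := tilt (- K).
have n1 : #|[set Q in C | v \in Q]| = 1%N.
  apply/eqP; have := atmost1 C Csup Cex.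
  rewrite leq_eqVlt => /orP[//|]; rewrite ltnS leqn0 => /eqP n0.
  have : \sum_(Q in C) d Q <= \sum_(Q : {set V}) `|d Q|.
    rewrite [leRHS](bigID (mem C)) /= -[leLHS]addr0; apply: lerD.
      by apply: ler_sum => Q _; apply: ler_norm.
    by apply: sumr_ge0.
  rewrite trv0 addr0 in covv; move: Cd; rewrite covv n0 -/A /K; lra.
exists C; split; [exact: lift | | ].
  move=> u uW; have [->|uv] := eqVneq u v; first exact: n1.
  by apply: Cex; rewrite !inE uv.
rewrite splitW trd0 addr0.
by rewrite trv0 addr0 in covv; move: Cd; rewrite covv n1; lra.
Qed.

(** * Broken edges as a hypergraph cut *)

Definition splits {V : finType} (Q T : {set V}) : bool :=
  ~~ (T \subset Q) && ~~ (T \subset ~: Q).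

(** A set [T] unsplit by [X] lies inside or outside [X], so it is unsplit by
    [X :|: Y] in the first case and by [X :&: Y] in the second; if it is also
    unsplit by [Y], neither of the two splits it. *)
Lemma splits_submod {V : finType} (T X Y : {set V}) :
  (splits (X :|: Y) T + splits (X :&: Y) T <= splits X T + splits Y T)%N.
Proof.
have X1 : T \subset X -> T \subset X :|: Y by move=> TX; rewrite subsetU ?TX.
have Y1 : T \subset Y -> T \subset X :|: Y.
  by move=> TY; rewrite subsetU ?TY ?orbT.
have X2 : T \subset ~: X -> T \subset ~: (X :&: Y).
  by move=> TX; rewrite setCI subsetU ?TX.
have Y2 : T \subset ~: Y -> T \subset ~: (X :&: Y).
  by move=> TY; rewrite setCI subsetU ?TY ?orbT.
move: X1 Y1 X2 Y2; rewrite /splits subsetI setCU subsetI.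
case: (T \subset X :|: Y); case: (T \subset ~: (X :&: Y));
  case: (T \subset X); case: (T \subset Y); case: (T \subset ~: X);
  case: (T \subset ~: Y) => X1 Y1 X2 Y2 //;
  by [have := X1 isT|have := Y1 isT|have := X2 isT|have := Y2 isT].
Qed.

(** Splitting does not distinguish [Y] from its complement, which turns
    submodularity into posimodularity. *)
Lemma splits_posimod {V : finType} (T X Y : {set V}) :
  (splits (X :\: Y) T + splits (Y :\: X) T <= splits X T + splits Y T)%N.
Proof.
have splitsC Z : splits (~: Z) T = splits Z T by rewrite /splits setCK andbC.
rewrite -(splitsC Y) -(splitsC (Y :\: X)) setDE addnC [in leqLHS]addnC.
have -> : ~: (Y :\: X) = X :|: ~: Y by rewrite setDE setCI setCK setUC.
by rewrite addnC; apply: splits_submod.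
Qed.

Definition upstream {V : finType} (E : {set {set V}}) (A : rel {set V})
    (f : {set V}) : {set V} :=
  \bigcup_(e in [set e in E | connect A e f]) e.

Lemma boundaryE {V : finType} (E : {set {set V}}) (Q e : {set V}) :
  simple_graph E -> (e \in boundary E Q) = (e \in E) && splits Q e.
Proof.
move=> hE; rewrite inE; case eE: (e \in E) => //=.
apply/idP/idP.
  case/existsP=> u /andP[uQ] /existsP[v]; rewrite !inE => /andP[vQ /eqP->].
  by rewrite /splits !subUset !sub1set !inE uQ (negbTE vQ) andbF.
case/andP=> /subsetPn[v ve vQ] /subsetPn[u ue]; rewrite inE negbK => uQ.
apply/existsP; exists u; rewrite uQ /=; apply/existsP; exists v.
rewrite inE vQ /= eq_sym eqEcard subUset !sub1set ue ve /= hE // cards2.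
by have [uv|] := eqVneq u v => //; rewrite uv (negbTE vQ) in uQ.
Qed.

(** Walk back along a precedence path ending in [f]: consecutive edges share a
    vertex, so an unsplit edge lies on the same side of [Q] as its successor. *)
Lemma upstream_one_side {V : finType} (E : {set {set V}}) (A : rel {set V})
    (Q f : {set V}) :
  precedence_graph E A ->
  (forall e, e \in E -> connect A e f -> (e \subset Q) || (e \subset ~: Q)) ->
  f \subset Q -> upstream E A f \subset Q.
Proof.
move=> [AE Aadj _] unsplit fQ; apply/bigcupsP=> e; rewrite inE => /andP[eE].
case/connectP=> p; elim: p e eE => [|g p IHp] e eE /=; first by move=> _ <-.
case/andP=> Aeg gp fp.
have gE : g \in E by have [] := AE _ _ Aeg.
have ef : connect A e f.
  by apply/connectP; exists (g :: p); rewrite //= Aeg.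
have [u [v [y [eu gv]]]] := Aadj _ _ Aeg.
have vQ : v \in Q by apply: (subsetP (IHp g gE gp fp)); rewrite gv !inE eqxx.
have /orP[//|/subsetP/(_ v)] := unsplit e eE ef.
by rewrite eu !inE eqxx orbT vQ => /(_ isT).
Qed.

Lemma brokenE {V : finType} (E : {set {set V}}) (A : rel {set V})
    (Q f : {set V}) :
  simple_graph E -> precedence_graph E A ->
  (f \in broken E A Q) = (f \in E) && splits Q (upstream E A f).
Proof.
move=> hE hA; apply/bigcupP/andP.
  case=> e; rewrite boundaryE // => /andP[eE /andP[eQ eQC]].
  rewrite inE => /andP[fE ef]; split=> //.
  have eup : e \subset upstream E A f by apply: bigcup_sup; rewrite inE eE.
  by rewrite /splits !(contra (subset_trans eup)).
case=> fE /andP[upQ upQC].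
have [/existsP[e /and3P[eE ef eQ]]|] :=
    boolP [exists e, [&& e \in E, connect A e f & splits Q e]].
  by exists e; rewrite ?boundaryE ?eE // inE fE.
move=> /existsPn nosplit.
have unsplit e : e \in E -> connect A e f ->
    (e \subset Q) || (e \subset ~: Q).
  move=> eE ef; have := nosplit e; rewrite eE ef /= /splits negb_and !negbK.
  by [].
have /orP[fQ|fQC] := unsplit f fE (connect0 _ _).
  (* f inside Q drags its whole upstream inside Q; likewise for ~: Q. *)
  by rewrite (upstream_one_side E A Q f hA unsplit fQ) in upQ.
rewrite (upstream_one_side E A (~: Q) f hA _ fQC) // in upQC.
by move=> e eE ef; rewrite setCK orbC; apply: unsplit.
Qed.

Lemma broken_weightE {R : realFieldType} {V : finType} (E : {set {set V}})
    (A : rel {set V}) (w : {set V} -> R) (Q : {set V}) :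
  simple_graph E -> precedence_graph E A ->
  \sum_(e in broken E A Q) w e =
  \sum_(e in E) w e * (splits Q (upstream E A e))%:R.
Proof.
move=> hE hA; rewrite big_mkcond [RHS]big_mkcond; apply: eq_bigr => e _.
rewrite brokenE //; case: (e \in E); case: (splits _ _);
  by rewrite /= ?mulr1 ?mulr0.
Qed.

Lemma broken_weight_submodular {R : realFieldType} {V : finType}
    (E : {set {set V}}) (A : rel {set V}) (w : {set V} -> R) :
  simple_graph E -> precedence_graph E A ->
  (forall e, e \in E -> 0 < w e) ->
  submodular (fun Q => \sum_(e in broken E A Q) w e).
Proof.
move=> hE hA hw X Y; rewrite !broken_weightE // -!big_split /=.
apply: ler_sum => e eE; rewrite -!mulrDr ler_pM2l ?hw // -!natrD ler_nat.
exact: splits_submod.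
Qed.

Lemma broken_weight_posimodular {R : realFieldType} {V : finType}
    (E : {set {set V}}) (A : rel {set V}) (w : {set V} -> R) :
  simple_graph E -> precedence_graph E A ->
  (forall e, e \in E -> 0 < w e) ->
  posimodular (fun Q => \sum_(e in broken E A Q) w e).
Proof.
move=> hE hA hw X Y; rewrite !broken_weightE // -!big_split /=.
apply: ler_sum => e eE; rewrite -!mulrDr ler_pM2l ?hw // -!natrD ler_nat.
exact: splits_posimod.
Qed.

(** * Anchors from optimality *)

(** Otherwise the light sets, those with [c X < c Q], cover [Q].  For two light
    sets [X] and [Y], posimodularity makes [X :\: Y] or [Y :\: X] light, and
    replacing [X] or [Y] by it keeps the union.  A cover by light sets of
    minimum total size is therefore disjoint, i.e. a partition with no heavy
    part. *)
Lemma exists_heavy_vertex {R : realFieldType} {V : finType}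
    (c : {set V} -> R) (Q : {set V}) :
  posimodular c ->
  (forall P, partition P Q -> exists2 X, X \in P & c Q <= c X) ->
  exists2 u, u \in Q &
    forall X : {set V}, u \in X -> X \subset Q -> c Q <= c X.
Proof.
move=> posc heavy.
pose light (X : {set V}) := (X \subset Q) && (c X < c Q).
have [/existsP[u /andP[uQ /forallP hu]]|] := boolP [exists u, (u \in Q) &&
    [forall X : {set V}, (u \in X) ==> ~~ light X]].
  exists u => // X uX XQ; rewrite leNgt; apply/negP=> cX.
  by have := hu X; rewrite uX /light XQ cX.
move=> /existsPn nocore; exfalso.
pose covers (C : {set {set V}}) :=
  [forall X in C, light X] && (cover C == Q).
have covL : covers [set X | light X].
  apply/andP; split; first by apply/forallP=> X; rewrite inE; apply/implyP.
  rewrite eqEsubset; apply/andP; split.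
    by apply/bigcupsP=> X; rewrite inE => /andP[].
  apply/subsetP=> u uQ; have := nocore u; rewrite uQ /= => /forallPn[X].
  rewrite negb_imply negbK => /andP[uX lX].
  by apply/bigcupP; exists X; rewrite ?inE.
case: (arg_minnP (fun C : {set {set V}} => \sum_(X in C) #|X|)%N covL) => C.
move=> /andP[/forallP Clight /eqP Ccov] Cmin.
have {}Clight X : X \in C -> light X by apply/implyP/Clight.
have replace (X Y : {set V}) : X \in C -> Y \in C -> X != Y ->
    light (X :\: Y) -> [disjoint X & Y].
  move=> XC YC XY lXY; apply: contraT => nXY.
  have YCX : Y \in C :\ X by rewrite !inE eq_sym XY.
  (* Trading X for X :\: Y would lower the total size. *)
  have : covers ((X :\: Y) |: (C :\ X)).
    apply/andP; split.
      apply/forallP=> Z; rewrite !inE; apply/implyP=> /orP[/eqP->//|/andP[_]].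
      exact: Clight.
    apply/eqP/setP=> z; rewrite -Ccov; apply/bigcupP/bigcupP=> -[Z].
      rewrite !inE => /orP[/eqP->|/andP[_ ZC]] zZ; last by exists Z.
      by exists X => //; move: zZ; rewrite inE => /andP[].
    move=> ZC zZ; have [zY|zY] := boolP (z \in Y).
      by exists Y => //; rewrite inE YCX orbT.
    have [ZX|ZX] := eqVneq Z X.
      by exists (X :\: Y); rewrite ?setU11 // inE zY -ZX.
    by exists Z => //; rewrite !inE ZX ZC orbT.
  move=> /Cmin; rewrite leqNgt; case/negP.
  rewrite [ltnRHS](bigD1 X) //=; apply: (@leq_ltn_trans
    (#|X :\: Y| + \sum_(Z in C :\ X) #|Z|)%N).
    have [XYC|XYC] := boolP (X :\: Y \in C :\ X); last by rewrite big_setU1.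
    by rewrite (setUidPr _) ?sub1set // leq_addl.
  have -> : (\sum_(i in C | i != X) #|i| = \sum_(Z in C :\ X) #|Z|)%N.
    by apply: eq_bigl => Z; rewrite !inE andbC.
  rewrite ltn_add2r -[ltnRHS](cardsID Y X) -[ltnLHS]add0n ltn_add2r card_gt0.
  by rewrite setI_eq0.
have triv : trivIset C.
  apply/trivIsetP=> X Y XC YC XY.
  have /andP[XQ cX] := Clight X XC; have /andP[YQ cY] := Clight Y YC.
  have := posc X Y; case: (ltP (c (X :\: Y)) (c Q)) => cXY cc.
    apply: replace => //; rewrite /light cXY andbT.
    exact: subset_trans (subsetDl _ _) XQ.
  rewrite disjoint_sym; apply: replace; rewrite // 1?eq_sym // /light.
  rewrite (subset_trans (subsetDl _ _) YQ) /=; lra.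
have [|X] := heavy (C :\ set0).
  apply/and3P; split.
  - rewrite -Ccov eqEsubset; apply/andP; split; apply/bigcupsP=> X.
      by rewrite !inE => /andP[_ XC]; apply: bigcup_sup.
    move=> XC; have [->|X0] := eqVneq X set0; first exact: sub0set.
    by apply: bigcup_sup; rewrite !inE X0.
  - exact: trivIsetS (subD1set _ _) triv.
  - by rewrite !inE eqxx.
by rewrite !inE => /andP[_ /Clight/andP[_]]; rewrite ltNge => /negbTE->.
Qed.

Lemma superadditive_trivIset {R : realFieldType} {V : finType}
    (lam : {set V} -> R) (P : {set {set V}}) :
  lam set0 = 0 ->
  (forall S T : {set V}, [disjoint S & T] ->
     lam S + lam T <= lam (S :|: T)) ->
  trivIset P -> \sum_(X in P) lam X <= lam (cover P).
Proof.
move=> lam0 lamD; have [n] := ubnP #|P|; elim: n => // n IHn in P *.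
rewrite ltnS => Pn triv.
have [->|[X XP]] := set_0Vmem P; first by rewrite big_set0 /cover big_set0 lam0.
have P1 : (#|P :\ X| < n)%N by move: Pn; rewrite (cardsD1 X P) XP.
have := IHn _ P1 (trivIsetS (subD1set _ _) triv).
rewrite (big_setD1 X XP) /=.
have -> : cover P = X :|: cover (P :\ X) by rewrite /cover (big_setD1 X XP).
have : [disjoint X & cover (P :\ X)].
  apply: bigcup_disjoint => Y; rewrite !inE => /andP[YX YP].
  by move/trivIsetP: triv => /(_ X Y XP YP); rewrite eq_sym => /(_ YX).
by move/lamD; lra.
Qed.

Lemma partition_indicator {R : realFieldType} {V : finType}
    (P : {set {set V}}) (Q : {set V}) (v : V) :
  partition P Q -> \sum_(X in P) (v \in X)%:R = (v \in Q)%:R :> R.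
Proof.
move=> /and3P[/eqP <- triv _].
have ind (X : {set V}) : (v \in X)%:R = \sum_(z in X) (z == v)%:R :> R.
  have [vX|vX] := boolP (v \in X).
    rewrite (big_setD1 v) //= eqxx big1 ?addr0 // => z; rewrite !inE.
    by case/andP=> /negbTE->.
  rewrite big1 // => z zX; have [zv|//] := eqVneq z v.
  by rewrite -zv zX in vX.
by rewrite ind (big_trivIset _ triv); apply: eq_bigr => X _.
Qed.

(** The upper bounds follow from the covering constraints, except for the empty
    set, which occurs in none of them. *)
Lemma lpm_feasible_cover {R : realType} {V : finType}
    (x : {ffun {set V} -> R}) :
  (forall v : V, \sum_(Q : {set V}) (v \in Q)%:R * x Q = 1) ->
  (forall Q, 0 <= x Q) -> x set0 <= 1 -> lpm_feasible x.
Proof.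
move=> cov x0 x01; split=> // Q; rewrite x0 /=.
have [->//|[v vQ]] := set_0Vmem Q.
rewrite -(cov v) (bigD1 Q) //= vQ mul1r lerDl.
by apply: sumr_ge0 => X _; rewrite mulr_ge0.
Qed.

Definition transfer {R : realType} {V : finType} (x : {ffun {set V} -> R})
    (P : {set {set V}}) (Q : {set V}) : {ffun {set V} -> R} :=
  [ffun X => x X + x Q * ((X \in P)%:R - (X == Q)%:R)].

Lemma transfer_sum {R : realType} {V : finType} (x : {ffun {set V} -> R})
    (P : {set {set V}}) (Q : {set V}) (a : {set V} -> R) :
  \sum_X a X * transfer x P Q X =
  \sum_X a X * x X + x Q * (\sum_(X in P) a X - a Q).
Proof.
under eq_bigr => X _ do rewrite ffunE mulrDr mulrCA mulrBr.
rewrite big_split /= -mulr_sumr sumrB; congr (_ + _ * (_ - _)).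
  by rewrite [RHS]big_mkcond; apply: eq_bigr => X _; rewrite -mulrb mulr_natr.
rewrite (bigD1 Q) //= eqxx mulr1 big1 ?addr0 // => X /negbTE->.
by rewrite mulr0.
Qed.

Lemma transfer_feasible {R : realType} {V : finType} (x : {ffun {set V} -> R})
    (P : {set {set V}}) (Q : {set V}) :
  lpm_feasible x -> partition P Q -> Q != set0 -> lpm_feasible (transfer x P Q).
Proof.
move=> [cov xb] PQ Q0; have /and3P[_ _ P0] := PQ.
have xQ : 0 <= x Q by case/andP: (xb Q).
apply: lpm_feasible_cover => [v|X|].
- by rewrite transfer_sum cov (partition_indicator _ _ _ PQ) subrr mulr0 addr0.
- rewrite ffunE; have /andP[xX _] := xb X.
  have [->|_] := eqVneq X Q; case: (_ \in P); rewrite /=; lra.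
rewrite ffunE (negbTE P0) eq_sym (negbTE Q0) subrr mulr0 addr0.
by case/andP: (xb set0).
Qed.

(** A partition of [Q] into parts with [c X < c Q] would be cheaper than [Q]:
    its cost is below [c Q] times the sum of the [lam X], and superadditivity
    bounds that sum by [lam Q].  Passing from [c] to [h] removes the purchase
    costs and turns weak inequalities into strict ones. *)
Lemma optimal_anchors {R : realType} {V : finType}
    (E : {set {set V}}) (A : rel {set V})
    (ell : V -> R) (w : {set V} -> R) (lam : {set V} -> R)
    (x : {ffun {set V} -> R}) (Q : {set V}) :
  simple_graph E -> precedence_graph E A -> (forall v, 0 < ell v) ->
  (forall e, e \in E -> 0 < w e) -> failure_rate lam ->
  lpm_optimal E A ell w lam x -> 0 < x Q -> Q != set0 ->
  exists u, anchors (fun T => \sum_(e in broken E A T) w e) Q u.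
Proof.
move=> hE hA hell hw [lam0 lampos lamD] [xfeas xopt] xQ Q0.
pose h (T : {set V}) := \sum_(e in broken E A T) w e; rewrite -/h.
pose c T := h T + \sum_(u in T) ell u.
have ellD (X Y : {set V}) : X \subset Y ->
    \sum_(u in Y) ell u = \sum_(u in X) ell u + \sum_(u in Y :\: X) ell u.
  by move=> XY; rewrite (big_setID X) (setIidPr XY).
have ell0 (X : {set V}) : 0 <= \sum_(u in X) ell u.
  by apply: sumr_ge0 => u _; apply: ltW.
have h0 T : 0 <= h T.
  apply: sumr_ge0 => e /bigcupP[f _]; rewrite inE => /andP[eE _].
  exact/ltW/hw.
have posc : posimodular c.
  move=> X Y; have := broken_weight_posimodular E A w hE hA hw X Y.
  rewrite -/(h X) -/(h Y) -/(h (X :\: Y)) -/(h (Y :\: X)) /c.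
  rewrite (ellD (X :\: Y) X) ?subsetDl // (ellD (Y :\: X) Y) ?subsetDl //.
  by have := ell0 (X :\: (X :\: Y)); have := ell0 (Y :\: (Y :\: X)); lra.
have cost T : lru_cost E A ell w lam T = lam T * c T by [].
have heavy P : partition P Q -> exists2 X, X \in P & c Q <= c X.
  move=> PQ; have [/existsP[X /andP[XP cX]]|] :=
    boolP [exists X, (X \in P) && (c Q <= c X)]; first by exists X.
  move=> /existsPn nheavy; exfalso.
  have {}nheavy X : X \in P -> c X < c Q.
    by move=> XP; have := nheavy X; rewrite XP -ltNge.
  have := xopt _ (transfer_feasible x P Q xfeas PQ Q0).
  rewrite /lpm_objective transfer_sum lerDl pmulr_rge0 // subr_ge0 leNgt.
  case/negP; have /and3P[/eqP PcQ triv Pn0] := PQ.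
  have := superadditive_trivIset lam P lam0 lamD triv; rewrite PcQ => lamP.
  apply: (@lt_le_trans _ _ (\sum_(X in P) lam X * c Q)); last first.
    rewrite -mulr_suml cost ler_wpM2r //.
    by rewrite /c addr_ge0.
  have [P0|[X XP]] := set_0Vmem P.
    by rewrite -PcQ P0 /cover big_set0 eqxx in Q0.
  have lamX Y : Y \in P -> 0 < lam Y.
    by move=> YP; apply: lampos; apply: contraNneq Pn0 => <-.
  rewrite (bigD1 X) //= [ltRHS](bigD1 X) //=; apply: ltr_leD.
    by rewrite cost ltr_pM2l ?lamX ?nheavy.
  apply: ler_sum => Y /andP[YP _].
  by rewrite cost ler_pM2l ?lamX // ltW // nheavy.
have [u uQ hu] := exists_heavy_vertex c Q posc heavy.
exists u; apply/anchorsP; split=> // X uX XQ.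
have := hu X uX (proper_sub XQ); rewrite /c (ellD X Q (proper_sub XQ)).
suff : 0 < \sum_(v in Q :\: X) ell v by lra.
have /properP[_ [v vQ vX]] := XQ.
rewrite (bigD1 v) ?inE ?vX //=; apply: ltr_pwDl => //.
by apply: sumr_ge0 => z _; apply: ltW.
Qed.

(** * Extreme optimal points *)

Theorem theorem4 (R : realType) (V : finType)
    (E : {set {set V}}) (A : rel {set V})
    (ell : V -> R) (w : {set V} -> R) (lam : {set V} -> R)
    (hE : simple_graph E) (hconn : connected_graph E)
    (hA : precedence_graph E A)
    (hell : forall v : V, 0 < ell v)
    (hw : forall e : {set V}, e \in E -> 0 < w e)
    (hlam : failure_rate lam)
    (x : {ffun {set V} -> R})
    (hext : extreme_point (@lpm_feasible R V) x)
    (hopt : lpm_optimal E A ell w lam x) :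
  forall Q : {set V}, x Q = 0 \/ x Q = 1.
Proof.
have [xfeas xext] := hext; have [cov xb] := xfeas.
have x0 Q : 0 <= x Q by case/andP: (xb Q).
have x1 Q : x Q <= 1 by case/andP: (xb Q).
pose h (T : {set V}) := \sum_(e in broken E A T) w e.
have [C [Csup Cex _]] : exists C : {set {set V}},
    [/\ forall Q, Q \in C -> 0 < x Q /\ Q :&: setT != set0,
        exact_cover setT C
      & \sum_(Q : {set V} | Q :&: setT != set0) x Q * 0 <= \sum_(Q in C) 0].
  apply: (anchored_supports_are_integral x setT h (fun=> 0) x0).
  - exact: broken_weight_submodular.
  - exact: broken_weight_posimodular.
  - by move=> v _; apply: cov.
  move=> Q xQ; rewrite setIT => Q0.
  exact: optimal_anchors hE hA hell hw hlam hopt xQ Q0.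
have set0C : set0 \notin C.
  by apply/negP=> /Csup[_]; rewrite set0I eqxx.
(* y is the integral cover, agreeing with x on the empty set; t is small
   enough for x - t y to stay nonnegative. *)
pose y := [ffun Q : {set V} => if Q == set0 then x set0 else (Q \in C)%:R : R].
pose t := 2^-1 * \prod_(Q in C) x Q.
have pr0 : 0 < \prod_(Q in C) x Q.
  by apply: prodr_gt0 => Q /Csup[].
have pr1 (D : {set {set V}}) : \prod_(Q in D) x Q <= 1.
  by apply: prodr_ile1 => Q _; rewrite x0 x1.
have tb : 0 < t < 1.
  have := pr1 C; rewrite /t => ?; apply/andP; split; lra.
have tx Q : Q \in C -> t <= x Q.
  move=> QC; rewrite /t (big_setD1 Q) //=.
  have := ler_piMr (x0 Q) (pr1 (C :\ Q)).
  have : 0 <= x Q * \prod_(i in C :\ Q) x i.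
    by apply: mulr_ge0 => //; apply: prodr_ge0.
  lra.
have covy v : \sum_(Q : {set V}) (v \in Q)%:R * y Q = 1.
  have := sum_indicator (R := R) C v.
  rewrite (Cex v (in_setT v)) mulr1n => covC; rewrite -[RHS]covC.
  rewrite [RHS]big_mkcond; apply: eq_bigr => Q _; rewrite ffunE.
  have [->|_] := eqVneq Q set0; first by rewrite inE mul0r (negbTE set0C).
  by case: (Q \in C); rewrite /= ?mulr1 ?mulr0.
have yfeas : lpm_feasible y.
  apply: lpm_feasible_cover => // [Q|]; rewrite ffunE; last by rewrite eqxx.
  by case: eqP => // _; rewrite ler0n.
pose z := [ffun Q => (x Q - t * y Q) / (1 - t)].
have t1 : 0 < 1 - t by lra.
have zfeas : lpm_feasible z.
  apply: lpm_feasible_cover => [v|Q|].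
  - under eq_bigr => Q _ do rewrite ffunE mulrA mulrBr [X in _ - X]mulrCA.
    by rewrite -mulr_suml sumrB -mulr_sumr covy cov mulr1 divff // gt_eqF.
  - rewrite ffunE; apply: divr_ge0; last exact: ltW.
    rewrite ffunE; case: eqP => [->|_].
      by have := x0 set0; rewrite subr_ge0 => ?; apply: ler_piMl => //; lra.
    case QC: (Q \in C); rewrite ?mulr1 ?mulr0 ?subr0 // subr_ge0.
    exact: tx.
  rewrite !ffunE eqxx ler_pdivrMr // mul1r.
  have := x1 set0; have := x0 set0; nra.
have [yx _] : y = x /\ z = x.
  apply: (xext y z t yfeas zfeas tb); apply/ffunP=> Q; rewrite [in RHS]ffunE.
  by rewrite [z Q]ffunE [(1 - t) * _]mulrC divfK ?gt_eqF // addrC subrK.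
have xnonempty Q : Q != set0 -> x Q = 0 \/ x Q = 1.
  move=> Q0; rewrite -yx ffunE (negbTE Q0).
  by case: (Q \in C); [right | left].
move=> Q; have [->|] := eqVneq Q set0; last exact: xnonempty.
(* The empty set: changing its coordinate alone keeps feasibility. *)
pose p (b : R) := [ffun T : {set V} => if T == set0 then b else x T].
have pfeas b : 0 <= b <= 1 -> lpm_feasible (p b).
  move=> /andP[b0 b1]; apply: lpm_feasible_cover => [v|T|].
  - rewrite -[RHS](cov v); apply: eq_bigr => T _; rewrite ffunE.
    by have [->|//] := eqVneq T set0; rewrite inE !mul0r.
  - by rewrite ffunE; case: eqP.
  by rewrite ffunE eqxx.
have := x0 set0; rewrite le_eqVlt => /orP[/eqP<-|xe0]; first by left.
have := x1 set0; rewrite le_eqVlt => /orP[/eqP->|xe1]; first by right.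
have [p1x _] : p 1 = x /\ p 0 = x.
  apply: (xext _ _ (x set0)); rewrite ?xe0 //.
  - by apply: pfeas; rewrite ler01 lexx.
  - by apply: pfeas; rewrite ler01 lexx.
  apply/ffunP=> T; rewrite !ffunE; have [->|_] := eqVneq T set0; lra.
by right; rewrite -p1x ffunE eqxx.
Qed.
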